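(* Let $N\ge 2$ be an integer and let $s,r$ be real numbers with $0<s\leq r<\frac{N-1}{2}$. Let $f,g,h:\mathbb{N}\to\mathbb{N}$ be functions such that for every $n\in\mathbb{N}$ \[ 1\leq f(n),\quad 1\le g(n)^{1/s},\quad 1\le h(n)^{1/r},\qquad f(n),\ g(n)^{1/s},\ h(n)^{1/r}\leq 2^{(N-1)^n}, \] and $2^{sN^n}g(n)\leq 2^{rN^n}h(n)$. For each $n\in\mathbb{N}$ define \[ a_n=2^{N^n}f(n),\qquad m_n=\lfloor 2^{sN^n}g(n)\rfloor, \] and let $\mathbb{D}_n=\{1=d_{n,1}<d_{n,2}<\dots<d_{n,m_n}\}\subset\mathbb{N}$ be any set of $m_n$ positive integers with smallest element $1$ and largest element $d_{n,m_n}\leq 2^{rN^n}h(n)$. Let \[ \mathcal{K}=\left\{\sum_{n=1}^{\infty}\frac{1}{d_n a_n} : d_n\in\mathbb{D}_n\text{ for every } n\in\mathbb{N}\right\}. \] Then \[ \dim_{\mathcal{H}}(\mathcal{K})\geq \frac{s}{(N-1)(N-s)}. \]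
   Context: $\dim_{\mathcal{H}}$ denotes Hausdorff dimension of a subset of $\mathbb{R}$. $\mathbb{N}=\{1,2,3,\dots\}$. The set $\mathcal{K}$ consists of all sums obtained as $(d_n)_{n\ge1}$ ranges over all sequences with $d_n\in\mathbb{D}_n$ for each $n$. *)

(* Defs.v *)
From HB Require Import structures.
From mathcomp Require Import all_boot all_order all_algebra.
From mathcomp Require Import all_classical all_reals all_analysis.
Set Implicit Arguments.
Unset Strict Implicit.
Unset Printing Implicit Defensive.
Import Order.TTheory GRing.Theory Num.Theory.
Import numFieldNormedType.Exports.
Local Open Scope classical_set_scope.
Local Open Scope ring_scope.

(* The element 0 is adjoined so that the empty set has diameter 0 and not -oo. *)
Definition diameter (R : realType) (A : set R) : \bar R :=
  ereal_sup (0%:E |` [set `|x - y|%:E | x in A & y in A]).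

(* diam(A)^t, where the empty set contributes 0 also for t = 0; for nonempty
   A, [poweR] gives diam(A)^0 = 1. *)
Definition diameter_pow (R : realType) (t : R) (A : set R) : \bar R :=
  if pselect (A = set0) then 0%:E else poweR (diameter A) t.

Definition is_delta_cover (R : realType) (delta : R) (A : set R)
    (U : nat -> set R) : Prop :=
  A `<=` \bigcup_i U i /\ forall i, (diameter (U i) <= delta%:E)%E.

Definition hausdorff_premeasure (R : realType) (t delta : R) (A : set R) :
    \bar R :=
  ereal_inf [set (\sum_(0 <= i <oo) diameter_pow t (U i))%E |
             U in is_delta_cover delta A].

Definition hausdorff_measure (R : realType) (t : R) (A : set R) : \bar R :=
  ereal_sup [set hausdorff_premeasure t delta A | delta in [set x : R | 0 < x]].

Definition hausdorff_dim (R : realType) (A : set R) : \bar R :=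
  ereal_inf [set t%:E | t in [set t : R | 0 <= t /\
                                          hausdorff_measure t A = 0%:E]].

(* All sequences are indexed by the positive integers: index 0 is ignored. *)
Definition reciprocal_sums (R : realType) (a : nat -> nat) (D : nat -> seq nat) :
    set R :=
  [set x : R | exists2 d : nat -> nat,
     forall n, (1 <= n)%N -> d n \in D n &
     (fun m => \sum_(1 <= n < m.+1) ((d n)%:R * (a n)%:R)^-1 : R) @ \oo --> x].

(* Main.v *)
Require Import Defs.
From HB Require Import structures.
From mathcomp Require Import all_boot all_order all_algebra.
From mathcomp Require Import all_classical all_reals all_analysis.
From mathcomp Require Import ring lra zify.
Set Implicit Arguments.
Unset Strict Implicit.
Unset Printing Implicit Defensive.
Import Order.TTheory GRing.Theory Num.Theory.
Import numFieldNormedType.Exports.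
Local Open Scope classical_set_scope.
Local Open Scope ring_scope.


(* Fix t < s / ((N-1)(N-s)); we parametrise part of K by phi : [0,1) -> K so that
   |y - y'| <= C |phi y - phi y'|^t, which transports Lebesgue measure to K and
   forces H^t(K) > 0.  Expand y in the mixed radix (m_n), n >= n0, and let the
   n-th digit of y choose the element of D_n (taking d_n = 1 for n < n0).  If y, y'
   first differ at level n, with digits j and j', then
     - |y - y'| <= min(1, 2|j - j'| / m_n) / (m_n0 ... m_(n-1));
     - elements of D_n differ by at least |j - j'| and are at most
       2^(r N^n) h(n), so, as 1 + 2r < N, the n-th terms differ by at least
       4|j - j'| / B with B = 2^(N^(n+1)), while the tails are at most 2 / B.
   Hence |y - y'| <= (B delta / m_n)^t / (m_n0 ... m_(n-1)) with
   delta = |phi y - phi y'|.  With m_n >= 2^(sigma N^n) for a suitable sigma < s,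
   (B / m_n)^t is at most a constant times m_n0 ... m_(n-1). *)

(** * Hausdorff measure and maps with Hölder inverse *)

Lemma le_diameter (R : realType) (A : set R) (x y : R) :
  A x -> A y -> (`|x - y|%:E <= diameter A)%E.
Proof.
by move=> Ax Ay; apply: ereal_sup_ubound; right; exists x => //; exists y.
Qed.

Lemma diameter_pow_ge0 (R : realType) (t : R) (A : set R) :
  (0 <= diameter_pow t A)%E.
Proof. by rewrite /diameter_pow; case: pselect => [|] /= _; rewrite ?lexx ?poweR_ge0. Qed.

Lemma le_diameter_pow (R : realType) (t : R) (A : set R) (x y : R) :
  0 <= t -> A x -> A y -> ((`|x - y| `^ t)%:E <= diameter_pow t A)%E.
Proof.
move=> t0 Ax Ay; rewrite /diameter_pow; case: pselect => [A0 /=|/= _].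
  by move: Ax; rewrite A0.
have d0 := le_diameter Ax Ay.
rewrite -poweR_EFin; apply: gt0_ler_poweR => //.
- by rewrite in_itv /= lee_fin normr_ge0 leey.
- rewrite in_itv /= leey andbT; apply: le_trans d0; by rewrite lee_fin.
Qed.

(** A cover of A by sets U_i pulls back under [phi] to a cover of [0, 1) by intervals of length 2 C
    diam(U_i)^t, whose total length cannot be below 1. *)
Lemma holder_inverse_hausdorff_measure (R : realType) (A : set R)
    (phi : R -> R) (t C : R) :
  0 <= t -> 0 < C ->
  (forall y : R, 0 <= y < 1 -> A (phi y)) ->
  (forall y y' : R, 0 <= y < 1 -> 0 <= y' < 1 ->
     `|y - y'| <= C * `|phi y - phi y'| `^ t) ->
  hausdorff_measure t A <> 0%E.
Proof.
move=> t0 C0 phiA phiH H0.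
(* The scale 1 keeps all diameters of the cover finite. *)
have H1 : (hausdorff_premeasure t 1 A <= 0)%E.
  by rewrite -H0; apply: ereal_sup_ubound; exists 1 => //=.
(* A sum below 1 / (4 C) makes the total length of the intervals less than 1/2. *)
have c0 : 0 < (4 * C)^-1 by rewrite invr_gt0 mulr_gt0.
have [_ [U [AU dU] <-]] : exists2 x, [set (\sum_(0 <= i <oo) diameter_pow t (U i))%E |
             U in is_delta_cover 1 A] x & (x < (4 * C)^-1%:E)%E.
  by apply: ereal_inf_lt; apply: le_lt_trans H1 _; rewrite lte_fin.
move=> sumlt.
pose P i (y : R) := 0 <= y < 1 /\ U i (phi y).
have UE i : diameter_pow t (U i) \is a fin_num.
  rewrite ge0_fin_numE ?diameter_pow_ge0// /diameter_pow; case: pselect => [|] /= _; first by rewrite ltry.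
  exact: poweR_lty (le_lt_trans (dU i) (ltry _)).
(* Any point of the preimage of [U i] serves as centre; the default 0 is harmless, as [V i] is empty
   when the preimage is. *)
pose y0 i := xget 0 [set y | P i y].
pose V i : set R := if pselect (exists y, P i y) then
   `[y0 i - C * fine (diameter_pow t (U i)), y0 i + C * fine (diameter_pow t (U i))]%classic
   else set0.
have mV i : measurable (V i) by rewrite /V; case: pselect => /= _; [exact: measurable_itv|exact: measurable0].
have lV i : (lebesgue_measure (V i) <= (2 * C)%:E * diameter_pow t (U i))%E.
  rewrite /V; case: pselect => [ex|/= _].
    rewrite lebesgue_measure_itv /=; case: ifP => _.
      rewrite -(fineK (UE i)) -EFinB -EFinM lee_fin /=; lra.
    by rewrite mule_ge0 ?diameter_pow_ge0// lee_fin; lra.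
  by rewrite measure0 mule_ge0 ?diameter_pow_ge0// lee_fin; lra.
have sV : `[0, 1[%classic `<=` \bigcup_(i in setT) V i.
  move=> y /=; rewrite in_itv /= => y01.
  have [i _ Ui] := AU _ (phiA _ y01).
  exists i => //; rewrite /V; case: pselect => [[z Pz]|/=]; last by case; exists y.
  have [w01 Uw] : P i (y0 i) by apply: (@xgetPex _ 0 [set y | P i y]); exists z.
  rewrite /= in_itv /=.
  have := phiH _ _ y01 w01.
  have := le_diameter_pow t0 Ui Uw.
  rewrite -(fineK (UE i)) lee_fin /= => le1 le2.
  have : `|y - y0 i| <= C * fine (diameter_pow t (U i)).
    by apply: le_trans le2 _; rewrite ler_pM2l.
  by rewrite ler_norml => /andP[??]; apply/andP; split; lra.
have : (lebesgue_measure (`[0%R, 1%R[%classic : set R)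
    <= \sum_(0 <= i <oo) lebesgue_measure (V i))%E.
  by apply: measure_sigma_subadditive => //; exact: measurable_itv.
rewrite lebesgue_measure_itv /= lte_fin ltr01 oppr0 adde0 => /le_trans.
have sle : (\sum_(0 <= i <oo) lebesgue_measure (V i) <=
   (2 * C)%:E * \sum_(0 <= i <oo) diameter_pow t (U i))%E.
  rewrite -nneseriesZl; last by move=> *; exact: diameter_pow_ge0.
  by apply: lee_nneseries => // i _; exact: lV.
move=> /(_ _ sle).
apply/negP; rewrite -ltNge.
have c2 : (0 < (2 * C)%:E)%E by rewrite lte_fin; lra.
apply: (@lt_le_trans _ _ ((2 * C)%:E * ((4 * C)^-1)%:E)%E).
  by rewrite lte_pmul2l.
rewrite -EFinM lee_fin.
have -> : 2 * C * (4 * C)^-1 = 2^-1 by field; lra.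
lra.
Qed.

(** * Partial sums, tails and gaps of the series *)

Lemma natr_dist_ge1 (R : realType) (i j : nat) :
  i != j -> 1 <= `|i%:R - j%:R| :> R.
Proof.
wlog lt : i j / (i < j)%N => [H neq|_].
  move: (neq); rewrite neq_ltn => /orP[lt|lt]; first exact: H.
  by rewrite distrC H// eq_sym.
by rewrite distrC -natrB ?normr_nat ?ler1n ?subn_gt0// ltnW.
Qed.

Definition partial_sum (R : realType) (a d : nat -> nat) (M : nat) : R :=
  \sum_(1 <= n < M.+1) ((d n)%:R * (a n)%:R)^-1.

Lemma partial_sumS (R : realType) (a d : nat -> nat) (M : nat) :
  partial_sum R a d M.+1 =
  partial_sum R a d M + ((d M.+1)%:R * (a M.+1)%:R)^-1.
Proof. by rewrite /partial_sum big_nat_recr. Qed.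

Lemma nondecreasing_partial_sum (R : realType) (a d : nat -> nat) :
  {homo partial_sum R a d : n M / (n <= M)%N >-> n <= M}.
Proof.
apply/nondecreasing_seqP => n.
by rewrite partial_sumS lerDl invr_ge0 mulr_ge0.
Qed.

(** With u_k = 2 / 2^(N^k), term k is at most u_k / 2 and u_(k+1) <= u_k / 2, so it is at most u_k -
    u_(k+1) and the bounds telescope. *)
Lemma partial_sum_tail (R : realType) (N : nat) (a d : nat -> nat)
    (n M : nat) :
  (2 <= N)%N -> (forall k, (1 <= k)%N -> (1 <= d k)%N) ->
  (forall k, (1 <= k)%N -> (2 ^ (N ^ k) <= a k)%N) -> (n <= M)%N ->
  partial_sum R a d M - partial_sum R a d n <= 2 / 2 ^+ (N ^ n.+1).
Proof.
move=> N2 d1 a1 nM.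
(* The subtracted term is what lets the induction on the number of terms close. *)
suff : partial_sum R a d M - partial_sum R a d n <=
    2 / 2 ^+ (N ^ n.+1) - 2 / 2 ^+ (N ^ M.+1).
  move=> /le_trans; apply; rewrite gerBl divr_ge0// exprn_ge0//.
rewrite -(subnKC nM); elim: (M - n)%N => [|k IH]; first by rewrite addn0; lra.
rewrite addnS partial_sumS; set K := (n + k)%N in IH *.
have t1 : ((d K.+1)%:R * (a K.+1)%:R)^-1 <= (2 ^+ (N ^ K.+1))^-1 :> R.
  have p0 : (0 : R) < 2 ^+ (N ^ K.+1) by rewrite exprn_gt0.
  have p1 : 2 ^+ (N ^ K.+1) <= (d K.+1)%:R * (a K.+1)%:R :> R.
    rewrite -natrM -natrX ler_nat; apply: leq_trans (a1 K.+1 isT) _.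
    by rewrite leq_pmull// d1.
  by rewrite lef_pV2// posrE; apply: lt_le_trans p1.
have t2 : 2 / 2 ^+ (N ^ K.+2) <= (2 ^+ (N ^ K.+1))^-1 :> R.
  rewrite ler_pdivrMr ?exprn_gt0// mulrC ler_pdivlMr ?exprn_gt0//.
  rewrite -exprS -!natrX ler_nat leq_pexp2l//.
  by rewrite ltn_exp2l.
lra.
Qed.

Lemma is_cvg_partial_sum (R : realType) (N : nat) (a d : nat -> nat) :
  (2 <= N)%N -> (forall k, (1 <= k)%N -> (1 <= d k)%N) ->
  (forall k, (1 <= k)%N -> (2 ^ (N ^ k) <= a k)%N) ->
  cvgn (partial_sum R a d).
Proof.
move=> N2 d1 a1; apply: nondecreasing_is_cvgn.
  exact: nondecreasing_partial_sum.
exists (partial_sum R a d 0 + 2 / 2 ^+ (N ^ 1)) => _ [M _ <-].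
have := partial_sum_tail R N2 d1 a1 (leq0n M); lra.
Qed.

(** The n-th terms are so far apart that the tails cancel at most half of their difference, since
    distinct integers differ by at least 1. *)
Lemma limn_partial_sum_gap (R : realType) (N : nat) (a d d' : nat -> nat)
    (n : nat) :
  (2 <= N)%N -> (1 <= n)%N ->
  (forall k, (1 <= k)%N -> (1 <= d k)%N) ->
  (forall k, (1 <= k)%N -> (1 <= d' k)%N) ->
  (forall k, (1 <= k)%N -> (2 ^ (N ^ k) <= a k)%N) ->
  (forall k, (k < n)%N -> d k = d' k) ->
  4 * ((d n)%:R * (d' n)%:R * (a n)%:R) <= 2 ^+ (N ^ n.+1) :> R ->
  2 * `|(d n)%:R - (d' n)%:R| <=
  2 ^+ (N ^ n.+1) * `|limn (partial_sum R a d) - limn (partial_sum R a d')|.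
Proof.
move=> N2 n1 d1 d'1 a1 eqd.
set B : R := 2 ^+ (N ^ n.+1) => gap.
have B0 : 0 < B by rewrite exprn_gt0.
have [->|neq] := eqVneq (d n) (d' n).
  by rewrite subrr normr0 mulr0 mulr_ge0 // ltW.
have tail e : (forall k, (1 <= k)%N -> (1 <= e k)%N) ->
    0 <= limn (partial_sum R a e) - partial_sum R a e n <= 2 / B.
  move=> e1; have cv := is_cvg_partial_sum (R := R) N2 e1 a1.
  rewrite subr_ge0 lerBlDl; apply/andP; split.
    by apply: nondecreasing_cvgn_le => //; exact: nondecreasing_partial_sum.
  apply: limr_le => //; exists n => // M /= nM.
  by have := partial_sum_tail R N2 e1 a1 nM; rewrite -/B; lra.
have head : partial_sum R a d n - partial_sum R a d' n =
    ((d' n)%:R - (d n)%:R) / ((d n)%:R * (d' n)%:R * (a n)%:R).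
  case: n n1 {B gap B0 tail neq} eqd => // n _ eqd.
  rewrite !partial_sumS.
  have -> : partial_sum R a d n = partial_sum R a d' n.
    by apply: eq_big_nat => k /andP[_ kn]; rewrite eqd.
  rewrite opprD addrACA subrr add0r.
  have ? := d1 n.+1 isT; have ? := d'1 n.+1 isT.
  have ? : (0 < a n.+1)%N by apply: leq_trans (a1 n.+1 isT); rewrite expn_gt0.
  by field; rewrite !pnatr_eq0; lia.
move: (tail d d1) (tail d' d'1) => /andP[tl tu] /andP[tl' tu'].
set x := limn _ in tl tu *; set x' := limn _ in tl' tu' *.
have dist1 : 1 <= `|(d n)%:R - (d' n)%:R| :> R by exact: natr_dist_ge1.
have a0 : (0 < a n)%N by apply: leq_trans (a1 n n1); rewrite expn_gt0.
set E : R := (d n)%:R * (d' n)%:R * (a n)%:R in gap head.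
have E0 : 0 < E by rewrite /E !mulr_gt0 // ltr0n ?d1 ?d'1.
have hd : 4 * `|(d n)%:R - (d' n)%:R| <=
    B * `|partial_sum R a d n - partial_sum R a d' n|.
  rewrite head normrM normfV (gtr0_norm E0) distrC mulrCA mulrA mulrC.
  rewrite -mulrA ler_wpM2l// ler_pdivlMr// .
(* Both tails lie in [0, 2 / B], so together they cost 2 / B rather than 4 / B. *)
have : `|partial_sum R a d n - partial_sum R a d' n| <= `|x - x'| + 2 / B.
  have -> : partial_sum R a d n - partial_sum R a d' n =
    (x - x') - ((x - partial_sum R a d n) - (x' - partial_sum R a d' n)).
    by ring.
  apply: (le_trans (ler_normB _ _)); rewrite lerD2l ler_norml; apply/andP; lra.
rewrite -(ler_pM2l B0) mulrDr mulrCA divff ?gt_eqF//.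
lra.
Qed.

(** * Spacing in strictly increasing lists *)

Lemma sorted_ltn_nth_gap (s : seq nat) (i k : nat) :
  sorted ltn s -> (i + k < size s)%N -> (nth 0%N s i + k <= nth 0%N s (i + k))%N.
Proof.
move=> ss; elim: k => [|k IH]; first by rewrite !addn0.
rewrite !addnS => lt_s; apply: leq_ltn_trans (IH (ltnW lt_s)) _.
by rewrite (sorted_ltn_nth ltn_trans) ?inE// ltnW.
Qed.

Lemma sorted_ltn_nth_dist (R : realType) (s : seq nat) (i j : nat) :
  sorted ltn s -> (i < size s)%N -> (j < size s)%N ->
  `|i%:R - j%:R| <= `|(nth 0%N s i)%:R - (nth 0%N s j)%:R| :> R.
Proof.
wlog ij : i j / (i <= j)%N => [H|] ss si sj.
  have [ij|/ltnW ji] := leqP i j; first exact: H.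
  by rewrite distrC [leRHS]distrC; exact: H.
have := @sorted_ltn_nth_gap s i (j - i) ss; rewrite subnKC// => /(_ sj) gap.
rewrite distrC [leRHS]distrC -!natrB// ?(leq_trans (leq_addr _ _) gap)//.
by rewrite !normr_nat ler_nat; lia.
Qed.

(** * Mixed radix expansions *)

Definition radix_prod (m : nat -> nat) (n0 n : nat) : nat :=
  \prod_(n0 <= k < n) m k.

(** The integer whose mixed radix digits are those of y at levels n0 to n - 1; the digit at level n
    is the prefix at n + 1 modulo [m n]. *)
Definition radix_prefix (R : realType) (m : nat -> nat) (n0 : nat) (y : R)
  (n : nat) : nat := Num.truncn (y * (radix_prod m n0 n)%:R).

Lemma radix_prod_gt0 (m : nat -> nat) (n0 n : nat) :
  (forall k, (n0 <= k)%N -> (1 < m k)%N) -> (0 < radix_prod m n0 n)%N.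
Proof.
move=> m1; rewrite /radix_prod big_nat_cond prodn_cond_gt0// => k.
by rewrite andbT => /andP[/m1/ltnW].
Qed.

Lemma radix_prodS (m : nat -> nat) (n0 n : nat) : (n0 <= n)%N ->
  radix_prod m n0 n.+1 = (radix_prod m n0 n * m n)%N.
Proof. by move=> ?; rewrite /radix_prod big_nat_recr. Qed.

Lemma radix_prefix_itv (R : realType) (m : nat -> nat) (n0 n : nat) (y : R) :
  0 <= y -> (radix_prefix m n0 y n)%:R <= y * (radix_prod m n0 n)%:R <
    (radix_prefix m n0 y n)%:R + 1.
Proof. by move=> y0; rewrite natr1; apply: truncn_itv; rewrite mulr_ge0. Qed.

Lemma radix_prefix_divn (R : realType) (m : nat -> nat) (n0 n : nat) (y : R) :
  (forall k, (n0 <= k)%N -> (1 < m k)%N) -> (n0 <= n)%N -> 0 <= y ->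
  (radix_prefix m n0 y n.+1 %/ m n)%N = radix_prefix m n0 y n.
Proof.
move=> m1 n0n y0; apply/esym/truncn_def.
have := radix_prefix_itv m n0 n.+1 y0; rewrite radix_prodS// natrM mulrA.
set z := y * _; set p := radix_prefix _ _ _ _ => /andP[le1 le2].
have mn : (0 < m n)%N by apply: ltnW (m1 _ n0n).
have mR : 0 < (m n)%:R :> R by rewrite ltr0n.
rewrite -(ler_pM2r mR) -(ltr_pM2r mR) -!natrM; apply/andP; split.
  by apply: le_trans le1; rewrite ler_nat leq_trunc_div.
apply: lt_le_trans le2 _; rewrite natr1 ler_nat.
exact: ltn_ceil.
Qed.

Lemma radix_first_difference (R : realType) (m : nat -> nat) (n0 : nat)
    (y y' : R) :
  (forall k, (n0 <= k)%N -> (1 < m k)%N) ->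
  0 <= y < 1 -> 0 <= y' < 1 -> y != y' ->
  exists2 n, (n0 <= n)%N &
    (forall k, (n0 <= k <= n)%N ->
       radix_prefix m n0 y k = radix_prefix m n0 y' k) /\
    radix_prefix m n0 y n.+1 <> radix_prefix m n0 y' n.+1.
Proof.
move=> m1 /andP[y0 y1] /andP[y'0 y'1] neq.
have ex : exists k, radix_prefix m n0 y (n0 + k) != radix_prefix m n0 y' (n0 + k).
  have d0 : 0 < `|y - y'| by rewrite normr_gt0 subr_eq0.
  (* The radix product at level n0 + k exceeds k, so cells of that level have length at most 1 / (k
     + 1) < |y - y'|. *)
  pose k := Num.truncn (`|y - y'|^-1); exists k.
  apply/eqP => eqp.
  have := radix_prefix_itv m n0 (n0 + k) y0; have := radix_prefix_itv m n0 (n0 + k) y'0.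
  rewrite eqp => /andP[u1 u2] /andP[v1 v2].
  have : `|y - y'| * (radix_prod m n0 (n0 + k))%:R < 1.
    rewrite -(normr_nat _ (radix_prod m n0 (n0 + k))) -normrM mulrBl ltr_norml.
    by apply/andP; lra.
  have kQ : (k < radix_prod m n0 (n0 + k))%N.
    elim: (k) => [|i IH]; first by rewrite radix_prod_gt0.
    have := m1 _ (leq_addr i n0).
    by rewrite addnS radix_prodS ?leq_addr//; nia.
  have dk : `|y - y'|^-1 < k.+1%:R by apply: truncnS_gt.
  move=> lt1; have : `|y - y'| * k.+1%:R < 1.
    by apply: le_lt_trans lt1; rewrite ler_pM2l// ler_nat.
  by rewrite -ltr_pdivlMl// mulr1 ltNge (ltW dk).
(* At level n0 both prefixes are the integer part 0, so the first difference comes later. *)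
case: (ex_minnP ex) => -[|k] /eqP neqk kmin.
  exfalso; apply: neqk; rewrite addn0 /radix_prefix /radix_prod big_geq// !mulr1.
  by rewrite !(@truncn_def _ _ 0)// ?y0 ?y'0.
exists (n0 + k)%N; first exact: leq_addr.
split; last by rewrite -addnS.
move=> i /andP[n0i ik]; apply/eqP; apply: contraTT isT => neqi.
have := kmin (i - n0)%N; rewrite subnKC// => /(_ neqi); lia.
Qed.


(** A common prefix puts y and y' in one cell of length 1 / [radix_prod m n0 n]; among its [m n]
    subcells they occupy those numbered [j y] and [j y']. *)
Lemma radix_dist (R : realType) (m : nat -> nat) (n0 n : nat) (y y' : R) :
  (forall k, (n0 <= k)%N -> (1 < m k)%N) -> (n0 <= n)%N ->
  0 <= y -> 0 <= y' ->
  let j x := (radix_prefix m n0 x n.+1 %% m n)%N in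
  radix_prefix m n0 y n = radix_prefix m n0 y' n ->
  radix_prefix m n0 y n.+1 <> radix_prefix m n0 y' n.+1 ->
  `|y - y'| * (radix_prod m n0 n)%:R <= 1 /\
  `|y - y'| * (radix_prod m n0 n)%:R * (m n)%:R <=
    2 * `|(j y)%:R - (j y')%:R|.
Proof.
move=> m1 n0n y0 y'0 j eqp neqp.
have m0 : (0 < m n)%N by exact: ltnW (m1 n n0n).
have := radix_prefix_itv m n0 n y0; have := radix_prefix_itv m n0 n y'0.
rewrite eqp => /andP[u1 u2] /andP[v1 v2]; split.
  rewrite -(normr_nat _ (radix_prod m n0 n)) -normrM mulrBl ler_norml.
  by apply/andP; lra.
have := radix_prefix_itv m n0 n.+1 y0; have := radix_prefix_itv m n0 n.+1 y'0.
have pE x : 0 <= x -> radix_prefix m n0 x n.+1 =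
    (radix_prefix m n0 x n * m n + j x)%N.
  by move=> x0; rewrite -(radix_prefix_divn m1 n0n x0); exact: divn_eq.
have neqj : j y != j y'.
  by apply/eqP => eqj; apply: neqp; rewrite !pE// eqp eqj.
rewrite !pE// eqp radix_prodS// natrD natrM [in X in X -> _]natrM => /andP[w1 w2].
rewrite natrD natrM => /andP[z1 z2].
rewrite -mulrA -natrM -(normr_nat _ (_ * m n)) -normrM mulrBl natrM.
(* Positions inside the subcells add at most one subcell length, which |j - j'| >= 1 absorbs. *)
apply: (@le_trans _ _ (`|(j y)%:R - (j y')%:R| + 1)).
  rewrite ler_norml.
  have := ler_norm ((j y)%:R - (j y')%:R : R).
  have := ler_norm (- ((j y)%:R - (j y')%:R) : R); rewrite normrN => k1 k2.
  by apply/andP; split; lra.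
have := natr_dist_ge1 R neqj; lra.
Qed.

(** * The Hölder bound for sums with prescribed digits *)

Lemma le_powR_min1 (R : realType) (u z t : R) :
  0 <= t <= 1 -> 0 <= z -> u <= 1 -> u <= z -> u <= z `^ t.
Proof.
move=> /andP[t0 t1] z0 u1 uz; have [z1|z1] := leP 1 z.
  apply: (le_trans u1); have := @ge0_ler_powR _ t t0 1 z.
  by rewrite powR1 !nnegrE ler01 z0; apply.
have [z00|zn0] := eqVneq z 0.
  by apply: (le_trans uz); rewrite {1}z00 powR_ge0.
apply: (le_trans uz); apply: ger1_powR => //.
by rewrite lt0r zn0 z0 ltW.
Qed.

(** The exponents sigma N^k, n0 <= k < n, form a geometric sum equal to sigma (N^n - N^n0) / (N -
    1). *)
Lemma radix_prod_lower (R : realType) (N : nat) (m : nat -> nat) (n0 n : nat)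
    (sigma : R) :
  (2 <= N)%N ->
  (forall k, (n0 <= k)%N -> 2 `^ (sigma * (N ^ k)%:R) <= (m k)%:R :> R) ->
  (n0 <= n)%N ->
  2 `^ (sigma * (N ^ n)%:R / (N%:R - 1)) <=
  2 `^ (sigma * (N ^ n0)%:R / (N%:R - 1)) * (radix_prod m n0 n)%:R.
Proof.
move=> N2 hm /subnKC <-; elim: (n - n0)%N => [|k IH].
  by rewrite addn0 /radix_prod big_geq// mulr1.
have N1 : 0 < N%:R - 1 :> R by rewrite subr_gt0 ltr1n.
rewrite addnS radix_prodS ?leq_addr// natrM mulrA.
set K := (n0 + k)%N in IH *.
have -> : sigma * (N ^ K.+1)%:R / (N%:R - 1) =
    sigma * (N ^ K)%:R / (N%:R - 1) + sigma * (N ^ K)%:R.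
  by rewrite expnS natrM; field; rewrite gt_eqF.
rewrite powRD; last by apply/implyP => _; rewrite pnatr_eq0.
by rewrite ler_pM ?powR_ge0// hm// leq_addr.
Qed.

(** The equation for t balances exponents: it makes 2^(t (N - sigma) N^n), which bounds (B / m_n)^t
    for B = 2^(N^(n+1)), equal to the lower bound for the radix product up to a constant independent
    of n. *)
Lemma digit_sums_hausdorff_measure (R : realType) (N n0 : nat)
    (a m : nat -> nat) (D : nat -> seq nat) (sigma t : R) :
  (2 <= N)%N -> (1 <= n0)%N ->
  (forall n, (1 <= n)%N -> (2 ^ (N ^ n) <= a n)%N) ->
  (forall n, (1 <= n)%N -> 1%N \in D n) ->
  (forall n e, (1 <= n)%N -> e \in D n -> (1 <= e)%N) ->
  (forall n, (1 <= n)%N -> sorted ltn (D n)) ->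
  (forall n, (1 <= n)%N -> size (D n) = m n) ->
  (forall n, (n0 <= n)%N -> (1 < m n)%N) ->
  (forall n, (n0 <= n)%N -> 2 `^ (sigma * (N ^ n)%:R) <= (m n)%:R :> R) ->
  (forall n e e', (n0 <= n)%N -> e \in D n -> e' \in D n ->
     4 * (e%:R * e'%:R * (a n)%:R) <= 2 ^+ (N ^ n.+1) :> R) ->
  0 <= t <= 1 -> t * (N%:R - sigma) = sigma / (N%:R - 1) ->
  hausdorff_measure t (reciprocal_sums a D : set R) <> 0%E.
Proof.
move=> N2 n0_1 ha hD1 hDpos hDs hDm hm1 hm hgap t01 tE.
(* Reduction modulo [m n] keeps the index inside [D n]. *)
pose dig (y : R) n := if (n0 <= n)%N then
  nth 0%N (D n) (radix_prefix m n0 y n.+1 %% m n) else 1%N.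
have idx n x : (n0 <= n)%N -> (x %% m n < size (D n))%N.
  move=> n0n; rewrite hDm ?(leq_trans n0_1)// ltn_mod.
  by apply: ltnW; exact: hm1.
have digD (y : R) n : (1 <= n)%N -> dig y n \in D n.
  rewrite /dig => n1; case: ifP => [n0n|_]; last exact: hD1.
  by rewrite mem_nth// idx.
have dig1 (y : R) n : (1 <= n)%N -> (1 <= dig y n)%N.
  by move=> n1; apply: (hDpos n) => //; exact: digD.
pose C : R := 2 `^ (sigma * (N ^ n0)%:R / (N%:R - 1)).
have C0 : 0 < C by exact: powR_gt0.
move: (t01) => /andP[t0 t1].
apply: (@holder_inverse_hausdorff_measure _ _
  (fun y => limn (partial_sum R a (dig y))) t C t0 C0).
  move=> y _; exists (dig y); first exact: digD.
  exact: (@is_cvg_partial_sum R N a _ N2 (dig1 y) ha).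
move=> y y' y01 y'01.
have [->|neq] := eqVneq y y'.
  by rewrite subrr normr0 mulr_ge0 ?powR_ge0// ltW.
have [n n0n [eqp neqp]] := radix_first_difference hm1 y01 y'01 neq.
move: y01 y'01 => /andP[y0 _] /andP[y'0 _].
have eqn : radix_prefix m n0 y n = radix_prefix m n0 y' n by rewrite eqp ?n0n/=.
have [d1 dj] := radix_dist hm1 n0n y0 y'0 eqn neqp.
have n1 : (1 <= n)%N by exact: leq_trans n0n.
have gap : 2 * `|(dig y n)%:R - (dig y' n)%:R| <= 2 ^+ (N ^ n.+1) *
    `|limn (partial_sum R a (dig y)) - limn (partial_sum R a (dig y'))|.
  apply: limn_partial_sum_gap => //; [exact: dig1|exact: dig1| |].
    move=> k kn; rewrite /dig; case: ifP => // n0k.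
    by rewrite eqp// kn andbT ltnW.
  by apply: hgap => //; exact: digD.
set delta := `|limn _ - _| in gap *.
set B : R := 2 ^+ (N ^ n.+1) in gap.
have B0 : 0 < B by rewrite exprn_gt0.
have mR : 0 < (m n)%:R :> R by rewrite ltr0n ltnW// hm1.
have QR : 0 < (radix_prod m n0 n)%:R :> R by rewrite ltr0n radix_prod_gt0.
have dist : `|y - y'| * (radix_prod m n0 n)%:R * (m n)%:R <= B * delta.
  apply: (le_trans dj); apply: le_trans gap; rewrite ler_pM2l//.
  by rewrite /dig n0n; apply: sorted_ltn_nth_dist; rewrite ?hDs ?idx.
have de0 : 0 <= delta by exact: normr_ge0.
(* Being at most 1 and at most z = B delta / m_n, the left side is at most z^t, because 0 <= t <=
   1. *)
have : `|y - y'| * (radix_prod m n0 n)%:R <= (B / (m n)%:R * delta) `^ t.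
  apply: le_powR_min1 => //; first by rewrite mulr_ge0// divr_ge0// ltW.
  by rewrite mulrAC ler_pdivlMr.
rewrite powRM ?divr_ge0 ?(ltW B0)// -ler_pdivlMr// => /le_trans; apply.
rewrite ler_pdivrMr// mulrAC ler_wpM2r ?powR_ge0//.
apply: le_trans (radix_prod_lower N2 hm n0n).
(* Both sides become t-th powers, leaving B / m_n <= 2^((N - sigma) N^n). *)
have -> : sigma * (N ^ n)%:R / (N%:R - 1) = (N%:R - sigma) * (N ^ n)%:R * t.
  by rewrite mulrAC -tE; ring.
rewrite powRrM; apply: ge0_ler_powR; rewrite ?nnegrE ?powR_ge0 ?divr_ge0//.
  exact: ltW.
rewrite ler_pdivrMr// mulrBl powRB; last by apply/implyP => _; rewrite pnatr_eq0.
rewrite -natrM -expnS powR_mulrn// -/B -mulrA ler_peMr ?(ltW B0)//.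
rewrite mulrC ler_pdivlMr ?powR_gt0// mul1r.
exact: hm.
Qed.


(** * Growth of exponents, rounding, and extreme list elements *)

Lemma expn_eventually_ge (R : realType) (N : nat) (x : R) : (2 <= N)%N ->
  forall n, (Num.truncn x <= n)%N -> x <= (N ^ n)%:R.
Proof.
move=> N2 n xn; apply: le_trans (ltW (truncnS_gt x)) _.
by rewrite ler_nat; apply: leq_ltn_trans xn _; exact: ltn_expl.
Qed.

(** Bernoulli's inequality (1 + 1/p)^n >= 1 + n/p without denominators; p = N - 1 shows that (N -
    1)^n is negligible against N^n. *)
Lemma muln_expn_leS (p n : nat) : (n * p ^ n <= p * p.+1 ^ n)%N.
Proof.
suff : ((n + p) * p ^ n <= p * p.+1 ^ n)%N.
  by apply: leq_trans; rewrite leq_mul2r leq_addr orbT.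
elim: n => [|n IH]; first by rewrite !expn0 add0n.
rewrite !expnS [leqRHS]mulnCA; apply: (@leq_trans (p.+1 * ((n + p) * p ^ n))%N).
  by rewrite !mulnA leq_mul2r; apply/orP; right; lia.
by rewrite leq_mul2l IH orbT.
Qed.

(** This is 4 e e' a_n <= 2^(N^(n+1)) in base 2 logarithms: 4 contributes 2, and e, e', a_n
    contribute r, r, 1 times N^n + (N - 1)^n. The slack is c N^n with c = N - 1 - 2 r > 0. *)
Lemma exponent_eventually (R : realType) (N : nat) (r : R) :
  (2 <= N)%N -> 0 < r -> r < (N%:R - 1) / 2 ->
  exists n0, forall n, (n0 <= n)%N ->
    2 + (1 + 2 * r) * ((N ^ n)%:R + ((N - 1) ^ n)%:R) <= N%:R * (N ^ n)%:R.
Proof.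
move=> N2 r0 rN; pose c : R := N%:R - 1 - 2 * r.
have c0 : 0 < c by rewrite /c; lra.
(* Each threshold spends half of the slack: the first gives 2 <= (c / 2) N^n, the second N (N - 1)^n
   <= (c / 2) N^n. *)
exists (maxn (Num.truncn (4 / c)) (Num.truncn (2 * N%:R ^+ 2 / c)).+1) => n.
rewrite geq_max => /andP[/(expn_eventually_ge N2) X4 nge].
have nc : 2 * N%:R ^+ 2 <= n%:R * c :> R.
  rewrite -ler_pdivrMr//; apply: (le_trans (ltW (truncnS_gt _))).
  by rewrite ler_nat.
have := muln_expn_leS (N - 1) n; rewrite -[(N - 1).+1]addn1 subnK ?(ltnW N2)// => h.
have nY : n%:R * ((N - 1) ^ n)%:R <= N%:R * (N ^ n)%:R :> R.
  by rewrite -!natrM ler_nat; apply: leq_trans h _; rewrite leq_mul2r leq_subr orbT.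
move: X4; rewrite ler_pdivrMr//.
set X : R := (N ^ n)%:R in nY *; set Y : R := ((N - 1) ^ n)%:R in nY * => X4.
have Y0 : 0 <= Y by exact: ler0n.
have NR : 2 <= N%:R :> R by rewrite ler_nat.
have NY : N%:R * Y <= c / 2 * X.
  have N20 : 0 < 2 * N%:R :> R by lra.
  rewrite -(ler_pM2l N20).
  have h1 : 2 * N%:R ^+ 2 * Y <= n%:R * c * Y by rewrite ler_wpM2r.
  have h2 : c * (n%:R * Y) <= c * (N%:R * X) by rewrite ler_wpM2l// ltW.
  by move: h1 h2; rewrite expr2; lra.
have rY : (1 + 2 * r) * Y <= N%:R * Y by rewrite ler_wpM2r//; lra.
move: X4 NY rY; rewrite /c; lra.
Qed.

Lemma le_powR_of_root (R : realType) (x q : R) (k : nat) :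
  0 < q -> 0 <= x -> x `^ q^-1 <= 2 ^+ k -> x <= 2 `^ (q * k%:R).
Proof.
move=> q0 x0 xk; rewrite mulrC powRrM powR_mulrn//.
have -> : x = (x `^ q^-1) `^ q by rewrite -powRrM mulVf ?gt_eqF// powRr1.
by apply: ge0_ler_powR; rewrite ?nnegrE ?powR_ge0 ?exprn_ge0// ltW.
Qed.

(** Rounding down loses less than 1, so 2^(s K) < m + 1; as 2^(s K) is at least twice 2^(sigma K) >=
    1, the loss is absorbed. *)
Lemma floor_powR_lower (R : realType) (sigma s : R) (K G m : nat) :
  0 <= sigma -> (0 < G)%N -> 1 <= (s - sigma) * K%:R -> 2 <= s * K%:R ->
  m%:Z = Num.floor (2 `^ (s * K%:R) * G%:R) ->
  (1 < m)%N /\ 2 `^ (sigma * K%:R) <= m%:R :> R.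
Proof.
move=> sg0 G0 h1 h2 mE.
have P : 2 `^ (s * K%:R) < m%:R + 1.
  apply: (@le_lt_trans _ _ (2 `^ (s * K%:R) * G%:R)).
    by rewrite ler_peMr ?powR_ge0// ler1n.
  have := floorD1_gt (2 `^ (s * K%:R) * G%:R); rewrite -mE.
  by rewrite intrD.
have le21 x y : x <= y -> 2 `^ x <= 2 `^ y :> R by apply: ler_powR; rewrite ler1n.
split.
  have := le21 _ _ h2; rewrite powR_mulrn// => h.
  by rewrite -(ltr_nat R); lra.
have : 2 `^ (1 + sigma * K%:R) <= 2 `^ (s * K%:R) :> R by apply: le21; lra.
rewrite powRD ?pnatr_eq0 ?implybT// powRr1//.
have : 1 <= 2 `^ (sigma * K%:R) :> R.
  by have := le21 0 (sigma * K%:R); rewrite powRr0; apply; rewrite mulr_ge0.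
lra.
Qed.

Lemma mem_le_last (s : seq nat) (e : nat) :
  sorted ltn s -> e \in s -> (e <= last 0 s)%N.
Proof.
move=> ss es; have sz : (0 < size s)%N by case: s es {ss}.
have ie : (index e s < size s)%N by rewrite index_mem.
rewrite -nth_last -{1}(nth_index 0%N es).
have := @sorted_ltn_nth_gap s (index e s) ((size s).-1 - index e s) ss.
rewrite subnKC ?prednK//; last by rewrite -ltnS prednK.
by move=> /(_ (leqnn _)); apply: leq_trans; exact: leq_addr.
Qed.

Lemma head_le_mem (s : seq nat) (e : nat) :
  sorted ltn s -> e \in s -> (head 0 s <= e)%N.
Proof.
move=> ss es; rewrite -nth0 -{1}(nth_index 0%N es).
have := @sorted_ltn_nth_gap s 0 (index e s) ss; rewrite index_mem es.
by move=> /(_ isT); apply: leq_trans; exact: leq_addr.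
Qed.

(** * From nonzero measure to the dimension bound *)

Theorem theorem3 (R : realType) (N : nat) (s r : R)
  (f g h a m : nat -> nat) (D : nat -> seq nat)
  (hN : (2 <= N)%N)
  (hs : 0 < s) (hsr : s <= r) (hr : r < (N%:R - 1) / 2)
  (hf1 : forall n, (1 <= n)%N -> (1 <= f n)%N)
  (hg1 : forall n, (1 <= n)%N -> 1 <= (g n)%:R `^ s^-1)
  (hh1 : forall n, (1 <= n)%N -> 1 <= (h n)%:R `^ r^-1)
  (hf2 : forall n, (1 <= n)%N -> (f n)%:R <= 2 ^+ ((N - 1) ^ n) :> R)
  (hg2 : forall n, (1 <= n)%N -> (g n)%:R `^ s^-1 <= 2 ^+ ((N - 1) ^ n))
  (hh2 : forall n, (1 <= n)%N -> (h n)%:R `^ r^-1 <= 2 ^+ ((N - 1) ^ n))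
  (hgh : forall n, (1 <= n)%N ->
    2 `^ (s * (N ^ n)%:R) * (g n)%:R <= 2 `^ (r * (N ^ n)%:R) * (h n)%:R)
  (ha : forall n, (1 <= n)%N -> a n = (2 ^ (N ^ n) * f n)%N)
  (hm : forall n, (1 <= n)%N ->
    (m n)%:Z = Num.floor (2 `^ (s * (N ^ n)%:R) * (g n)%:R))
  (hDsorted : forall n, (1 <= n)%N -> sorted ltn (D n))
  (hDsize : forall n, (1 <= n)%N -> size (D n) = m n)
  (hDmin : forall n, (1 <= n)%N -> head 0%N (D n) = 1%N)
  (hDmax : forall n, (1 <= n)%N ->
    (last 0%N (D n))%:R <= 2 `^ (r * (N ^ n)%:R) * (h n)%:R) :
  ((s / ((N%:R - 1) * (N%:R - s)))%:E
     <= hausdorff_dim (reciprocal_sums a D : set R))%E.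

Proof.
have NR : 2 <= N%:R :> R by rewrite ler_nat.
have r0 : 0 < r by exact: lt_le_trans hsr.
(* It suffices that no t below the bound gives measure zero. *)
apply: le_ereal_inf_tmp => _ [t [t0 Ht] <-]; rewrite lee_fin leNgt; apply/negP.
rewrite ltr_pdivlMr; last by rewrite mulr_gt0; lra.
move=> tlt; move: Ht.
(* The solution of [t (N - sigma) (N - 1) = sigma]. *)
pose sigma : R := t * N%:R * (N%:R - 1) / (1 + t * (N%:R - 1)).
have den0 : 0 < 1 + t * (N%:R - 1) by rewrite ltr_pwDl// mulr_ge0; lra.
have sigma0 : 0 <= sigma.
  by rewrite divr_ge0 ?(ltW den0)// mulr_ge0 ?mulr_ge0//; lra.
(* Cleared of its denominator, this is t (N - 1) (N - s) < s. *)
have sigma_s : sigma < s by rewrite ltr_pdivrMr//; lra.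
have tE : t * (N%:R - sigma) = sigma / (N%:R - 1).
  by rewrite /sigma; field; rewrite !gt_eqF//; lra.
(* Since N - s >= 1 and s < N - 1, the bound s / ((N - 1) (N - s)) is below 1. *)
have t1 : t <= 1.
  rewrite leNgt; apply/negP => tgt.
  have p0 : 0 < (N%:R - 1) * (N%:R - s) by rewrite mulr_gt0; lra.
  have : 1 * ((N%:R - 1) * (N%:R - s)) < t * ((N%:R - 1) * (N%:R - s)).
    by rewrite ltr_pM2r.
  have : 1 * (N%:R - 1) <= (N%:R - s) * (N%:R - 1) by rewrite ler_wpM2r; lra.
  lra.
have [n1 hn1] := exponent_eventually hN r0 hr.
(* [n1] secures the gap bound; the two truncations give 2 <= s N^n and 1 <= (s - sigma) N^n, as
   rounding requires. *)
pose n0 := maxn 1 (maxn n1 (maxn (Num.truncn (2 / s)) (Num.truncn (s - sigma)^-1))).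
have n0P n : (n0 <= n)%N -> [/\ (1 <= n)%N, (n1 <= n)%N,
    2 <= s * (N ^ n)%:R & 1 <= (s - sigma) * (N ^ n)%:R].
  rewrite !geq_max => /and4P[-> -> /(expn_eventually_ge hN) h1].
  move=> /(expn_eventually_ge hN) h2; split => //.
    by move: h1; rewrite ler_pdivrMr// mulrC.
  by rewrite -ler_pdivrMl ?mulr1// subr_gt0.
(* g(n) = 0 is excluded because 0^(1/s) = 0 < 1. *)
have gpos n : (1 <= n)%N -> (0 < g n)%N.
  move=> /hg1; case: (g n) => // .
  by rewrite powR0 ?invr_neq0 ?gt_eqF// ler10.
have mP n : (n0 <= n)%N -> (1 < m n)%N /\ 2 `^ (sigma * (N ^ n)%:R) <= (m n)%:R :> R.
  move=> /n0P[n_1 _ h2 h1]; apply: (floor_powR_lower sigma0 (gpos n n_1) h1 h2).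
  exact: hm.
have D1 n : (1 <= n)%N -> 1%N \in D n.
  move=> n_1; have := hDmin n n_1; case: (D n) => //= x l ->; exact: mem_head.
apply: (@digit_sums_hausdorff_measure R N n0 a m D sigma t) => //.
- exact: leq_maxl.
- by move=> n n_1; rewrite ha// leq_pmulr// hf1.
- by move=> n e n_1 /(head_le_mem (hDsorted n n_1)); rewrite hDmin.
- by move=> n /mP[].
- by move=> n /mP[].
- move=> n e e' /n0P[n_1 n1n _ _] eD e'D.
  (* Bounds every element of [D n], using h(n) <= 2^(r (N - 1)^n). *)
  pose M : R := 2 `^ (r * ((N ^ n)%:R + ((N - 1) ^ n)%:R)).
  have leM x : x \in D n -> x%:R <= M.
    move=> xD; apply: (@le_trans _ _ (last 0%N (D n))%:R).
      by rewrite ler_nat; apply: mem_le_last => //; exact: hDsorted.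
    apply: (le_trans (hDmax n n_1)).
    rewrite /M mulrDr powRD ?pnatr_eq0 ?implybT// ler_wpM2l ?powR_ge0//.
    by apply: le_powR_of_root => //; exact: hh2.
  have leA : (a n)%:R <= 2 `^ ((N ^ n)%:R + ((N - 1) ^ n)%:R) :> R.
    rewrite ha// natrM natrX powRD ?pnatr_eq0 ?implybT// !powR_mulrn//.
    by rewrite ler_wpM2l ?exprn_ge0// hf2.
  apply: (@le_trans _ _ (2 `^ 2 * (M * M * 2 `^ ((N ^ n)%:R + ((N - 1) ^ n)%:R)))).
    apply: ler_pM => //.
      by rewrite powR_mulrn//; lra.
    apply: ler_pM => //.
    by apply: ler_pM => //; exact: leM.
  rewrite /M -!powRD ?pnatr_eq0 ?implybT// -powR_mulrn//.
  apply: ler_powR; first by rewrite ler1n.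
  by rewrite expnS natrM; have := hn1 n n1n; lra.
- by rewrite t0 t1.
Qed.
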